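(* Let $\Gamma$ be a countable discrete group. If $\Gamma$ is LEF, then $\Gamma$ is MF.
   Context: A group $\Gamma$ is LEF (locally embeddable into the class of finite groups) if for any finite subset $F\subset\Gamma$ there is a finite group $H$ and a map $\phi\colon\Gamma\to H$ that is both injective and multiplicative when restricted to $F$ (i.e. $\phi|_F$ is injective and $\phi(st)=\phi(s)\phi(t)$ for $s,t\in F$). For an increasing sequence $\vec n=(n_k)$ of positive integers let $Q_{\vec n}=\prod_k M_{n_k}(\mathbb{C})\big/\sum_k M_{n_k}(\mathbb{C})$, where $\prod_k M_{n_k}(\mathbb{C})$ is the C*-algebra of bounded sequences $(a_k)$, $a_k\in M_{n_k}(\mathbb{C})$, and $\sum_k M_{n_k}(\mathbb{C})$ is the closed ideal of sequences with $\|a_k\|\to0$. A countable group is MF if it embeds (as a group) in the unitary group of $Q_{\vec n}$ for some $\vec n$ (equivalently, for $\vec n=(1,2,3,\dots)$). *)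

(* Defs.v *)
From HB Require Import structures.
From mathcomp Require Import all_boot all_order all_algebra all_fingroup.
From mathcomp Require Import sesquilinear spectral complex generic_quotient.
From mathcomp Require Import all_classical all_reals all_analysis.

Set Warnings "-redundant-canonical-projection,-projection-no-head-constant".
Set Implicit Arguments.
Unset Strict Implicit.
Unset Printing Implicit Defensive.

Import Order.TTheory GRing.Theory Num.Theory.
Import numFieldNormedType.Exports.

Local Open Scope classical_set_scope.
Local Open Scope ring_scope.
Local Open Scope sesquilinear_scope.
Local Open Scope complex_scope.

Section operator_norm.
Variable R : realType.
Implicit Types m : nat.

Definition l2norm m (v : 'cV[R[i]]_m) : R :=
  Num.sqrt (\sum_i (complex.Re (v i 0) ^+ 2 + complex.Im (v i 0) ^+ 2)).

(* the C*-norm of M_m(C), acting on column vectors with the Euclidean norm *)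
Definition opnorm m (A : 'M[R[i]]_m) : R :=
  sup [set l2norm (A *m v) | v in [set v | l2norm v <= 1]].

Lemma l2normE m (v : 'cV[R[i]]_m) :
  (l2norm v)%:C = sqrtC (dotmx v^T v^T) :> R[i].
Proof.
have d0 : 0 <= dotmx v^T v^T by exact: dnorm_ge0.
have s0 : 0 <= \sum_i (complex.Re (v i 0) ^+ 2 + complex.Im (v i 0) ^+ 2).
  by apply: sumr_ge0 => i _; rewrite addr_ge0 ?sqr_ge0.
apply/eqP; rewrite -(@eqrXn2 _ 2) ?sqrtC_ge0 //; last by rewrite ler0c sqrtr_ge0.
rewrite sqrtCK -rmorphXn /= sqr_sqrtr // dotmxE mxE rmorph_sum /=; apply/eqP.
apply: eq_bigr => i _; rewrite !mxE; case: (v i 0) => a b /=.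
by rewrite -normCK normc_def /= -rmorphXn /= sqr_sqrtr // addr_ge0 ?sqr_ge0.
Qed.

Lemma l2norm_ge0 m (v : 'cV[R[i]]_m) : 0 <= l2norm v.
Proof. exact: sqrtr_ge0. Qed.

Lemma l2norm_sqr m (v : 'cV[R[i]]_m) :
  ((l2norm v) ^+ 2)%:C = dotmx v^T v^T :> R[i].
Proof. by rewrite rmorphXn /= l2normE sqrtCK. Qed.

Lemma l2normD m (u v : 'cV[R[i]]_m) : l2norm (u + v) <= l2norm u + l2norm v.
Proof.
rewrite -lecR rmorphD /= !l2normE linearD /=.
exact: (triangle_lerif (@dotmx R[i] m)).
Qed.

Lemma l2normZ m (c : R[i]) (v : 'cV[R[i]]_m) :
  (l2norm (c *: v))%:C = `|c| * (l2norm v)%:C :> R[i].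
Proof.
rewrite !l2normE linearZ /= (dnormZ (@dotmx R[i] m)) sqrtCM ?nnegrE ?exprn_ge0//.
  by rewrite sqrCK.
Qed.

Lemma l2norm0 m : l2norm (0 : 'cV[R[i]]_m) = 0.
Proof. by apply/complexI; rewrite -[X in l2norm X](scale0r 0) l2normZ normr0 mul0r. Qed.

Lemma l2normN m (v : 'cV[R[i]]_m) : l2norm (- v) = l2norm v.
Proof.
by apply/complexI; rewrite -scaleN1r l2normZ normrN1 mul1r.
Qed.

Lemma l2norm_eq0 m (v : 'cV[R[i]]_m) : l2norm v = 0 -> v = 0.
Proof.
move=> v0; have := l2norm_sqr v; rewrite v0 expr0n /= => /esym/eqP.
rewrite (dnorm_eq0 (@dotmx R[i] m)) => /eqP/(congr1 trmx).
by rewrite trmxK trmx0.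
Qed.

Lemma l2norm_sum m (I : Type) (r : seq I) (F : I -> 'cV[R[i]]_m) :
  l2norm (\sum_(i <- r) F i) <= \sum_(i <- r) l2norm (F i).
Proof.
elim/big_rec2: _ => [|i x y _ h]; last first.
  by apply: le_trans (l2normD _ _) _; rewrite lerD2l.
by rewrite l2norm0.
Qed.

Lemma norm_entry_le m (v : 'cV[R[i]]_m) j : `|v j 0| <= (l2norm v)%:C.
Proof.
case E : (v j 0) => [a b]; rewrite normc_def lecR /l2norm ler_sqrt /=; last first.
  by apply: sumr_ge0 => i _; rewrite addr_ge0 ?sqr_ge0.
rewrite (bigD1 j) //= E /= lerDl.
by apply: sumr_ge0 => i _; rewrite addr_ge0 ?sqr_ge0.
Qed.

Lemma l2norm_mulmx_bounded m (A : 'M[R[i]]_m) :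
  exists2 M : R, 0 <= M & forall v, l2norm (A *m v) <= M * l2norm v.
Proof.
exists (\sum_j l2norm (col j A)).
  by apply: sumr_ge0 => j _; exact: l2norm_ge0.
move=> v; have -> : A *m v = \sum_j v j 0 *: col j A.
  apply/colP => i; rewrite summxE mxE; apply: eq_bigr => j _.
  by rewrite !mxE mulrC.
apply: le_trans (l2norm_sum _ _) _; rewrite mulr_suml.
apply: ler_sum => j _; rewrite -lecR l2normZ rmorphM /= mulrC.
by rewrite ler_wpM2l ?norm_entry_le // ler0c l2norm_ge0.
Qed.

Lemma l2norm_mulmx_le m (A : 'M[R[i]]_m) v :
  l2norm (A *m v) <= opnorm A * l2norm v.
Proof.
have [M M0 hM] := l2norm_mulmx_bounded A.
have [v0|v0] := eqVneq (l2norm v) 0.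
  by have := hM v; rewrite v0 !mulr0.
have vgt0 : 0 < l2norm v by rewrite lt_def v0 l2norm_ge0.
pose c : R[i] := ((l2norm v)^-1)%:C.
have nc : `|c| = c by rewrite ger0_norm // ler0c invr_ge0 l2norm_ge0.
have sc (w : 'cV[R[i]]_m) : l2norm (c *: w) = (l2norm v)^-1 * l2norm w.
  by apply/complexI; rewrite l2normZ nc -rmorphM.
rewrite -ler_pdivrMr // mulrC -sc scalemxAr; apply: ub_le_sup.
  exists M => _ [w /= w1 <-]; apply: le_trans (hM w) _.
  by rewrite ler_piMr.
by exists (c *: v) => //=; rewrite sc mulVf.
Qed.

Lemma opnorm_le m (A : 'M[R[i]]_m) (M : R) : 0 <= M ->
  (forall v, l2norm (A *m v) <= M * l2norm v) -> opnorm A <= M.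
Proof.
move=> M0 hM; apply: ge_sup.
  exists (l2norm (A *m 0)); exists 0 => //=.
  by rewrite l2norm0 ler01.
by move=> _ [v /= v1 <-]; apply: le_trans (hM v) _; rewrite ler_piMr.
Qed.

Lemma opnorm_ge0 m (A : 'M[R[i]]_m) : 0 <= opnorm A.
Proof.
have [M M0 hM] := l2norm_mulmx_bounded A.
apply: (le_trans (l2norm_ge0 (A *m 0))); apply: ub_le_sup.
- by exists M => _ [w /= w1 <-]; apply: le_trans (hM w) _; rewrite ler_piMr.
- exists 0 => //=.
  by rewrite l2norm0 ler01.
Qed.

Lemma opnorm0 m : opnorm (0 : 'M[R[i]]_m) = 0.
Proof.
apply/eqP; rewrite eq_le opnorm_ge0 andbT; apply: opnorm_le => // v.
by rewrite mul0mx mul0r l2norm0.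
Qed.

Lemma opnorm1_le m : opnorm (1%:M : 'M[R[i]]_m) <= 1.
Proof. by apply: opnorm_le => // v; rewrite mul1mx mul1r. Qed.

Lemma opnormN m (A : 'M[R[i]]_m) : opnorm (- A) = opnorm A.
Proof. by congr sup; apply: eq_imagel => v _; rewrite mulNmx l2normN. Qed.

Lemma opnormD m (A B : 'M[R[i]]_m) : opnorm (A + B) <= opnorm A + opnorm B.
Proof.
apply: opnorm_le => [|v]; first by rewrite addr_ge0 ?opnorm_ge0.
rewrite mulmxDl mulrDl; apply: le_trans (l2normD _ _) _.
by rewrite lerD ?l2norm_mulmx_le.
Qed.

Lemma opnormM m (A B : 'M[R[i]]_m) : opnorm (A *m B) <= opnorm A * opnorm B.
Proof.
apply: opnorm_le => [|v]; first by rewrite mulr_ge0 ?opnorm_ge0.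
rewrite -mulmxA -mulrA; apply: le_trans (l2norm_mulmx_le _ _) _.
by rewrite ler_wpM2l ?opnorm_ge0 ?l2norm_mulmx_le.
Qed.

Lemma opnorm_adj_le m (A : 'M[R[i]]_m) : opnorm (A ^t*) <= opnorm A.
Proof.
apply: opnorm_le => [|v]; first exact: opnorm_ge0.
set w := A ^t* *m v.
have [->|w0] := eqVneq (l2norm w) 0.
  by rewrite mulr_ge0 ?opnorm_ge0 ?l2norm_ge0.
have wgt0 : 0 < l2norm w by rewrite lt_def w0 l2norm_ge0.
have e : dotmx w^T w^T = dotmx v^T (A *m w)^T.
  rewrite !dotmxE {1}/w !trmx_mul !map_mxM /= -!mulmxA; congr ((_ *m _) 0 0).
  by rewrite map_trmx trmxK; congr (_ *m _); apply/matrixP => i j; rewrite !mxE.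
have : l2norm w ^+ 2 <= l2norm v * l2norm (A *m w).
  have : `|dotmx w^T w^T| <= (l2norm v)%:C * (l2norm (A *m w))%:C.
    by rewrite e !l2normE; exact: (CauchySchwarz_sqrt (@dotmx R[i] m) _ _).1.
  by rewrite -l2norm_sqr ger0_norm ?ler0c ?sqr_ge0 // -rmorphM lecR.
move=> h; rewrite -(ler_pM2r wgt0) -expr2; apply: le_trans h _.
by rewrite mulrAC [leRHS]mulrC ler_wpM2l ?l2norm_ge0 ?l2norm_mulmx_le.
Qed.

End operator_norm.

Section matrix_sequences.
Variables (R : realType) (n : nat -> nat).

Definition mxseq := forall k, 'M[R[i]]_(n k).
Implicit Types a b c : mxseq.

HB.instance Definition _ := Choice.copy mxseq (forall k, 'M[R[i]]_(n k)).

Let seq0 : mxseq := fun k => 0.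
Let seq1 : mxseq := fun k => 1%:M.
Let seqN a : mxseq := fun k => - a k.
Let seqD a b : mxseq := fun k => a k + b k.
Let seqM a b : mxseq := fun k => a k *m b k.

Let seqDA : associative seqD.
Proof. by move=> a b c; apply/functional_extensionality_dep => k; exact: addrA. Qed.
Let seqDC : commutative seqD.
Proof. by move=> a b; apply/functional_extensionality_dep => k; exact: addrC. Qed.
Let seq0D : left_id seq0 seqD.
Proof. by move=> a; apply/functional_extensionality_dep => k; exact: add0r. Qed.
Let seqNDx : left_inverse seq0 seqN seqD.
Proof. by move=> a; apply/functional_extensionality_dep => k; exact: addNr. Qed.
Let seqMA : associative seqM.
Proof. by move=> a b c; apply/functional_extensionality_dep => k; exact: mulmxA. Qed.
Let seq1M : left_id seq1 seqM.
Proof. by move=> a; apply/functional_extensionality_dep => k; exact: mul1mx. Qed.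
Let seqM1 : right_id seq1 seqM.
Proof. by move=> a; apply/functional_extensionality_dep => k; exact: mulmx1. Qed.
Let seqMDl : left_distributive seqM seqD.
Proof. by move=> a b c; apply/functional_extensionality_dep => k; exact: mulmxDl. Qed.
Let seqMDr : right_distributive seqM seqD.
Proof. by move=> a b c; apply/functional_extensionality_dep => k; exact: mulmxDr. Qed.

HB.instance Definition _ := GRing.isPzRing.Build mxseq
  seqDA seqDC seq0D seqNDx seqMA seq1M seqM1 seqMDl seqMDr.

Definition seq_adj a : mxseq := fun k => (a k) ^t*.

Definition bounded_seq : {pred mxseq} :=
  fun a => `[< exists M : R, forall k, opnorm (a k) <= M >].

Fact bounded_seq_subring : subring_closed bounded_seq.
Proof.
split=> [|a b /asboolP[M hM] /asboolP[N hN]|a b /asboolP[M hM] /asboolP[N hN]].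
- by apply/asboolP; exists 1 => k; exact: opnorm1_le.
- apply/asboolP; exists (M + N) => k; apply: le_trans (opnormD _ _) _.
  by rewrite lerD // opnormN.
- apply/asboolP; exists (M * N) => k; apply: le_trans (opnormM _ _) _.
  by rewrite ler_pM ?opnorm_ge0.
Qed.
HB.instance Definition _ :=
  GRing.isSubringClosed.Build mxseq bounded_seq bounded_seq_subring.

Fact bounded_seq_adj a : a \in bounded_seq -> seq_adj a \in bounded_seq.
Proof.
move=> /asboolP[M hM]; apply/asboolP; exists M => k.
exact: le_trans (opnorm_adj_le _) (hM k).
Qed.

(* prod_k M_(n k)(C): the bounded sequences, as a subring of mxseq *)
Record prodM := ProdM { prodM_val :> mxseq; _ : prodM_val \in bounded_seq }.
HB.instance Definition _ := [isSub for prodM_val].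
HB.instance Definition _ := [Choice of prodM by <:].
HB.instance Definition _ :=
  GRing.SubChoice_isSubPzRing.Build mxseq bounded_seq prodM bounded_seq_subring.

Implicit Types x y : prodM.

Definition prodM_adj x : prodM := ProdM (bounded_seq_adj (valP x)).

(* sum_k M_(n k)(C), a self-adjoint two-sided ideal by the facts below *)
Definition sumM : {pred prodM} :=
  fun x => `[< opnorm (val x k) @[k --> \oo] --> (0 : R) >].

Let squeeze0 (u v : nat -> R) : (forall k, 0 <= u k <= v k) ->
  v k @[k --> \oo] --> (0 : R) -> u k @[k --> \oo] --> (0 : R).
Proof.
by move=> uv v0; apply: (squeeze_cvgr _ (cvg_cst 0) v0); near=> k; exact: uv.
Unshelve. all: by end_near. Qed.

Fact sumM_zmod : zmod_closed sumM.
Proof.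
split=> [|x y /asboolP x0 /asboolP y0]; apply/asboolP.
  under eq_fun do rewrite opnorm0; exact: cvg_cst.
apply: (@squeeze0 _ (fun k => opnorm (val x k) + opnorm (val y k))) => [k|].
  by rewrite opnorm_ge0 /= -[opnorm (val y k)]opnormN opnormD.
by have h := cvgD x0 y0; rewrite addr0 in h; apply: h.
Qed.
HB.instance Definition _ := GRing.isZmodClosed.Build prodM sumM sumM_zmod.

Fact sumM_mull x y : y \in sumM -> x * y \in sumM.
Proof.
case: x => a abd; have /asboolP[M hM] := abd; move=> /asboolP y0; apply/asboolP.
apply: (@squeeze0 _ (fun k => M * opnorm (val y k))) => [k|].
  rewrite opnorm_ge0 /=; apply: le_trans (opnormM _ _) _.
  by rewrite ler_wpM2r ?opnorm_ge0.
by rewrite -[0 in X in _ --> X](mulr0 M); apply: cvgM => //; exact: cvg_cst.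
Qed.

Fact sumM_mulr x y : x \in sumM -> x * y \in sumM.
Proof.
case: y => a abd; have /asboolP[M hM] := abd; move=> /asboolP x0; apply/asboolP.
apply: (@squeeze0 _ (fun k => opnorm (val x k) * M)) => [k|].
  rewrite opnorm_ge0 /=; apply: le_trans (opnormM _ _) _.
  by rewrite ler_wpM2l ?opnorm_ge0.
by rewrite -[0 in X in _ --> X](mul0r M); apply: cvgM => //; exact: cvg_cst.
Qed.

Fact sumM_adj x : x \in sumM -> prodM_adj x \in sumM.
Proof.
move=> /asboolP x0; apply/asboolP.
by apply: squeeze0 x0 => k; rewrite opnorm_ge0 opnorm_adj_le.
Qed.

End matrix_sequences.

Section quotient_algebra.
Variables (R : realType) (n : nat -> nat).
Local Open Scope quotient_scope.

(* Q_n. MathComp equips quotients by an ideal with a product only over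
   commutative rings, so the product and the adjoint are defined here on
   representatives; QM_pi and Qadj_pi state that they do not depend on the
   choice. Scalars and the quotient norm play no role in the unitary group and
   are left out. *)
Definition Qalg : Type := Quotient.quot (@sumM R n).
HB.instance Definition _ := Choice.on Qalg.
HB.instance Definition _ := GRing.Zmodule.on Qalg.
HB.instance Definition _ := EqQuotient.on Qalg.
Implicit Types (x y : prodM R n) (u v : Qalg).

Definition Q1 : Qalg := \pi_Qalg 1.
Definition QM u v : Qalg := \pi_Qalg (repr u * repr v).
Definition Qadj u : Qalg := \pi_Qalg (prodM_adj (repr u)).

Lemma pi_QP x y : reflect (\pi_Qalg x = \pi_Qalg y) (x - y \in @sumM R n).
Proof. by rewrite Quotient.idealrBE; exact: eqP. Qed.

Lemma pi_QD x y : \pi_Qalg (x + y) = \pi_Qalg x + \pi_Qalg y.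
Proof. exact: Quotient.pi_add. Qed.

Lemma QM_pi x y : QM (\pi_Qalg x) (\pi_Qalg y) = \pi_Qalg (x * y).
Proof.
apply/pi_QP; set x' := repr _; set y' := repr _.
have xx' : x' - x \in @sumM R n by apply/pi_QP; rewrite reprK.
have yy' : y' - y \in @sumM R n by apply/pi_QP; rewrite reprK.
have -> : x' * y' - x * y = (x' - x) * y' + x * (y' - y).
  by rewrite mulrBl mulrBr addrA subrK.
exact: rpredD (@sumM_mulr _ _ _ y' xx') (@sumM_mull _ _ x _ yy').
Qed.

Lemma prodM_adjB x y : prodM_adj (x - y) = prodM_adj x - prodM_adj y.
Proof.
apply/val_inj/functional_extensionality_dep => k; apply/matrixP => i j.
by rewrite !mxE rmorphB.
Qed.

Lemma prodM_adjM x y : prodM_adj (x * y) = prodM_adj y * prodM_adj x.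
Proof.
apply/val_inj/functional_extensionality_dep => k.
by rewrite /= /seq_adj trmx_mul map_mxM.
Qed.

Lemma prodM_adj1 : prodM_adj (1 : prodM R n) = 1.
Proof.
apply/val_inj/functional_extensionality_dep => k.
by rewrite /= /seq_adj trmx1 map_mx1.
Qed.

Lemma prodM_adjK x : prodM_adj (prodM_adj x) = x.
Proof.
by apply/val_inj/functional_extensionality_dep => k; exact: trmxCK.
Qed.

Lemma Qadj_pi x : Qadj (\pi_Qalg x) = \pi_Qalg (prodM_adj x).
Proof.
by apply/pi_QP; rewrite -prodM_adjB sumM_adj //; apply/pi_QP; rewrite reprK.
Qed.

Let QMA : associative QM.
Proof.
elim/quotW=> x; elim/quotW=> y; elim/quotW=> z.
by rewrite (QM_pi y) (QM_pi x) (QM_pi x) QM_pi mulrA.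
Qed.
Let Q1M : left_id Q1 QM.
Proof. by elim/quotW=> x; rewrite QM_pi mul1r. Qed.
Let QM1 : right_id Q1 QM.
Proof. by elim/quotW=> x; rewrite QM_pi mulr1. Qed.
Let QMDl : left_distributive QM +%R.
Proof.
elim/quotW=> x; elim/quotW=> y; elim/quotW=> z.
by rewrite -pi_QD (QM_pi x) (QM_pi y) (QM_pi (x + y)) mulrDl pi_QD.
Qed.
Let QMDr : right_distributive QM +%R.
Proof.
elim/quotW=> x; elim/quotW=> y; elim/quotW=> z.
by rewrite -pi_QD (QM_pi x y) (QM_pi x z) (QM_pi x (y + z)) mulrDr pi_QD.
Qed.
HB.instance Definition _ :=
  GRing.Zmodule_isPzRing.Build Qalg QMA Q1M QM1 QMDl QMDr.

Lemma QadjM u v : Qadj (u * v) = Qadj v * Qadj u.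
Proof.
elim/quotW: u => x; elim/quotW: v => y.
by rewrite [_ * _]QM_pi !Qadj_pi prodM_adjM [RHS]QM_pi.
Qed.

Lemma QadjK u : Qadj (Qadj u) = u.
Proof. by elim/quotW: u => x; rewrite (Qadj_pi x) Qadj_pi prodM_adjK. Qed.

Lemma Qadj1 : Qadj 1 = 1.
Proof. exact: etrans (Qadj_pi 1) (congr1 _ prodM_adj1). Qed.

Definition unitary : {pred Qalg} :=
  fun u => (Qadj u * u == 1) && (u * Qadj u == 1).

Record unitary_group := Unitary { unitary_val :> Qalg; _ : unitary_val \in unitary }.
HB.instance Definition _ := [isSub for unitary_val].
HB.instance Definition _ := [Choice of unitary_group by <:].
Implicit Types a b : unitary_group.

Lemma unitary1 : 1 \in unitary.
Proof. by rewrite unfold_in Qadj1 mulr1 eqxx. Qed.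

Lemma unitaryM u v : u \in unitary -> v \in unitary -> u * v \in unitary.
Proof.
move=> /andP[/eqP u1 /eqP u2] /andP[/eqP v1 /eqP v2].
rewrite unfold_in QadjM -!mulrA (mulrA (Qadj u)) (mulrA v) u1 v2 !mul1r.
by rewrite u2 v1 eqxx.
Qed.

Lemma unitaryV u : u \in unitary -> Qadj u \in unitary.
Proof. by rewrite !unfold_in QadjK andbC. Qed.

Let ug1 := Unitary unitary1.
Let ugM a b := Unitary (unitaryM (valP a) (valP b)).
Let ugV a := Unitary (unitaryV (valP a)).

Let ugMA : associative ugM.
Proof. by move=> a b c; apply/val_inj; exact: mulrA. Qed.
Let ug1M : left_id ug1 ugM.
Proof. by move=> a; apply/val_inj; exact: mul1r. Qed.
Let ugM1 : right_id ug1 ugM.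
Proof. by move=> a; apply/val_inj; exact: mulr1. Qed.
Let ugVM : left_inverse ug1 ugV ugM.
Proof. by move=> a; apply/val_inj/eqP; case/andP: (valP a). Qed.
Let ugMV : right_inverse ug1 ugV ugM.
Proof. by move=> a; apply/val_inj/eqP; case/andP: (valP a). Qed.

HB.instance Definition _ := isGroup.Build unitary_group
  ugMA ug1M ugM1 ugVM ugMV.

End quotient_algebra.

Definition LEF (G : groupType) : Prop :=
  forall F : set G, finite_set F ->
  exists (H : finGroupType) (phi : G -> H),
    {in F &, injective phi} /\ {in F &, {morph phi : s t / (s * t)%g}}.

Definition MF (R : realType) (G : groupType) : Prop :=
  exists n : nat -> nat,
    [/\ forall k, (0 < n k)%N,
        {homo n : i j / (i < j)%N} &
        exists f : {multiplicative G -> unitary_group R n}, injective f].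

(* Main.v *)
Require Import Defs.
From HB Require Import structures.
From mathcomp Require Import all_boot all_order all_algebra all_fingroup.
From mathcomp Require Import sesquilinear complex generic_quotient.
From mathcomp Require Import all_classical all_reals all_analysis.

(** A LEF group has local models phi_k : G -> H_k in finite groups, exact on
    the first k elements. Embedding H_k in a symmetric group 'S_(n k), with n
    strictly increasing, turns phi_k into permutation matrices. These are
    unitary, and two distinct permutation matrices are at distance at least 1
    in operator norm, so that the sequence of the phi_k induces a homomorphism
    into the unitary group of Q_n that remains injective modulo null
    sequences. *)

Set Implicit Arguments.
Unset Strict Implicit.
Unset Printing Implicit Defensive.

Import Order.TTheory GRing.Theory Num.Theory.
Import numFieldNormedType.Exports.

Local Open Scope classical_set_scope.
Local Open Scope ring_scope.
Local Open Scope sesquilinear_scope.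
Local Open Scope complex_scope.
Local Open Scope quotient_scope.

(** Cayley's theorem with padding: [H] acts on itself by translations, and the [N - #|H|] additional
    points stay fixed. *)
Lemma finGroup_embed_Sym (H : finGroupType) (N : nat) : (#|H| <= N)%N ->
  exists r : H -> 'S_N, injective r /\ {morph r : x y / (x * y)%g}.
Proof.
move=> leHN; pose T : finType := (H + 'I_(N - #|H|))%type.
have <- : #|T| = N by rewrite card_sum card_ord subnKC.
(* Translation is on the right because products in ['S_N] compose from left to right. *)
pose act (h : H) (t : T) : T := if t is inl x then inl (x * h)%g else t.
have actM g h t : act (g * h)%g t = act h (act g t).
  by case: t => //= x; rewrite mulgA.
have act_inj h : injective (act h).
  by move=> [x|i] [y|j] //= [] /mulIg ->.
have act_ord_inj h :
    injective (fun i : 'I_#|T| => enum_rank (act h (enum_val i))).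
  by move=> i j /enum_rank_inj/act_inj/enum_val_inj.
exists (fun h => perm (act_ord_inj h)); split=> [g h|g h].
  (* The image of the identity under translation by [g] is [g] itself. *)
  move=> /permP/(_ (enum_rank (inl 1%g))).
  by rewrite !permE enum_rankK => /enum_rank_inj[]; rewrite !mul1g.
by apply/permP => i; rewrite permM !permE enum_rankK actM.
Qed.

Section permutation_matrices.
Variables (R : realType) (m : nat).
Implicit Types s t : 'S_m.

Local Notation pmx s := (perm_mx s : 'M[R[i]]_m).

Lemma opnorm_perm_mx_le1 s : opnorm (pmx s) <= 1.
Proof.
apply: opnorm_le => // v; rewrite mul1r -row_permE /l2norm.
rewrite [in leRHS](reindex_inj (@perm_inj _ s)) /=.
by under eq_bigr do rewrite mxE.
Qed.

Lemma adj_perm_mx s : (pmx s) ^t* = pmx s^-1.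
Proof. by rewrite tr_perm_mx map_perm_mx. Qed.

(** If [s i != t i], the basis vector at [s i] is a unit vector whose image under the difference has
    [i]-th entry 1 - 0. *)
Lemma opnorm_perm_mxB_ge1 s t : s != t -> 1 <= opnorm (pmx s - pmx t).
Proof.
move=> neq_st; have [i neq_i] : exists i, s i != t i.
  apply/existsP; apply: contraNT neq_st => /existsPn eq_st.
  by apply/eqP/permP => i; apply/eqP; rewrite -[_ == _]negbK eq_st.
pose v : 'cV[R[i]]_m := delta_mx (s i) 0.
have v1 : l2norm v = 1.
  rewrite /l2norm (bigD1 (s i)) //= big1 => [|j /negPf ne_j].
    by rewrite mxE !eqxx /= expr1n expr0n !addr0 sqrtr1.
  by rewrite mxE ne_j /= expr0n addr0.
have := l2norm_mulmx_le (pmx s - pmx t) v; rewrite v1 mulr1; apply: le_trans.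
rewrite -lecR; apply: le_trans (norm_entry_le _ i).
rewrite mulmxBl -!row_permE !mxE !eqxx eq_sym (negPf neq_i) /=.
by rewrite subr0 normr1.
Qed.

End permutation_matrices.

Section permutation_unitaries.
Variables (R : realType) (n : nat -> nat).
Implicit Types s t : forall k, 'S_(n k).

Lemma perm_seq_bounded s :
  ((fun k => perm_mx (s k)) : mxseq R n) \in @bounded_seq R n.
Proof. by apply/asboolP; exists 1 => k; exact: opnorm_perm_mx_le1. Qed.

Definition perm_seq s : prodM R n := ProdM (perm_seq_bounded s).

Lemma perm_seqM s t :
  perm_seq s * perm_seq t = perm_seq (fun k => (s k * t k)%g).
Proof.
by apply/val_inj/functional_extensionality_dep => k; rewrite /= perm_mxM.
Qed.

Lemma perm_seq1 : perm_seq (fun=> 1%g) = 1.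
Proof.
by apply/val_inj/functional_extensionality_dep => k; rewrite /= perm_mx1.
Qed.

Lemma perm_seq_adj s : prodM_adj (perm_seq s) = perm_seq (fun k => (s k)^-1%g).
Proof.
by apply/val_inj/functional_extensionality_dep => k; exact: adj_perm_mx.
Qed.

Lemma pi_perm_seqM s t :
  \pi_(Qalg R n) (perm_seq s) * \pi_(Qalg R n) (perm_seq t) =
  \pi_(Qalg R n) (perm_seq (fun k => (s k * t k)%g)).
Proof. by rewrite [LHS]QM_pi perm_seqM. Qed.

Lemma perm_seq_unitary s : \pi_(Qalg R n) (perm_seq s) \in @unitary R n.
Proof.
have pi_eq1 t : (forall k, t k = 1%g) -> \pi_(Qalg R n) (perm_seq t) = 1.
  move=> t1; rewrite (_ : t = fun=> 1%g) ?perm_seq1 //.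
  exact: functional_extensionality_dep.
apply/andP; rewrite Qadj_pi perm_seq_adj !pi_perm_seqM.
by split; apply/eqP/pi_eq1 => k; rewrite ?mulVg ?mulgV.
Qed.

(** The gap of 1 between distinct permutation matrices forces a null sequence of differences to
    vanish eventually. *)
Lemma pi_perm_seq_eq s t :
  \pi_(Qalg R n) (perm_seq s) = \pi_(Qalg R n) (perm_seq t) <->
  \forall k \near \oo, s k = t k.
Proof.
split=> [/pi_QP/asboolP st0|st].
  apply: filterS (cvgr_lt _ st0 _ (@ltr01 R)) => k.
  rewrite ltNge => st1; apply/eqP; apply: contraNT st1.
  exact: opnorm_perm_mxB_ge1.
apply/pi_QP/asboolP; apply: cvg_near_cst; near=> k.
rewrite -[X in opnorm X]/(perm_mx (s k) - perm_mx (t k)).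
by rewrite (_ : s k = t k) ?subrr ?opnorm0 //; near: k.
Unshelve. all: by end_near.
Qed.

End permutation_unitaries.

Theorem proposition2p13 (R : realType) (G : groupType)
  (countableG : countable [set: G]) : LEF G -> MF R G.
Proof.
move=> lefG; have /countable_injP[e e_inj] := countableG.
pose F k := [set g | (e g < k)%N].
(* Injectivity of [e] makes [F k] the preimage of a finite set under an injection. *)
have finF k : finite_set (F k).
  apply: finite_preimage (finite_II k) => g h _ _.
  by apply: e_inj; rewrite inE.
pose H k := projT1 (cid (lefG _ (finF k))).
pose phi k : G -> H k := projT1 (cid (projT2 (cid (lefG _ (finF k))))).
have phiP k : {in F k &, injective (phi k)} /\
    {in F k &, {morph phi k : s t / (s * t)%g}}.
  exact: projT2 (cid (projT2 (cid (lefG _ (finF k))))).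
have nearF g : \forall k \near \oo, g \in F k.
  by exists (e g).+1 => // k /= lt_gk; rewrite inE.
(* Partial sums of the positive orders dominate [#|H k|] and increase strictly, whatever the orders
   are. *)
pose n k := (\sum_(j < k.+1) #|H j|)%N.
have cardH_gt0 k : (0 < #|H k|)%N by apply/card_gt0P; exists 1%g.
have leHn k : (#|H k| <= n k)%N by rewrite /n big_ord_recr leq_addl.
have [r rP] : exists r : forall k, H k -> 'S_(n k),
    forall k, injective (r k) /\ {morph r k : x y / (x * y)%g}.
  exists (fun k => projT1 (cid (finGroup_embed_Sym (leHn k)))) => k.
  exact: projT2 (cid (finGroup_embed_Sym (leHn k))).
pose u g : unitary_group R n :=
  Unitary (perm_seq_unitary R (fun k => r k (phi k g))).
have uM : {morph u : g h / (g * h)%g}.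
  move=> g h; apply/val_inj; rewrite /= pi_perm_seqM.
  (* [phi k] respects this product once [g] and [h] both lie in [F k], hence for all large [k],
     which suffices in the quotient. *)
  apply/pi_perm_seq_eq; near=> k; rewrite -(rP k).2 (phiP k).2 //.
  - by near: k.
  - by near: k.
exists n; split=> [k||].
- exact: leq_trans (cardH_gt0 k) (leHn k).
- apply: homo_ltn => [|k]; first exact: ltn_trans.
  by rewrite [n k.+1]big_ord_recr -[X in (X < _)%N]addn0 ltn_add2l.
- pose U := isMultiplicative.Build _ _ u uM.
  exists (HB.pack_for {multiplicative G -> unitary_group R n} u U) => g h /=.
  move=> /(congr1 val)/pi_perm_seq_eq eq_gh.
  (* One index [k] separates [g] from [h]: it is taken so large that both lie in [F k] and their
     permutations agree. *)
  near \oo => k; apply: (phiP k).1.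
  + by near: k.
  + by near: k.
  + by apply: (rP k).1; near: k.
Unshelve. all: by end_near.
Qed.
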